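(* Let $p$ be a prime number different from $2$. Then, up to isomorphism, there are exactly two indecomposable solutions $(X,r)$ such that $\mathcal{G}(X,r)$ is isomorphic to the minimal non-cyclic group of size $4p$.
   Context: A solution is a pair $(X,r)$ with $X$ a non-empty set and $r:X\times X\to X\times X$, $r(x,y)=(\sigma_x(y),\tau_y(x))$, such that $(r\times \mathrm{id})(\mathrm{id}\times r)(r\times \mathrm{id})=(\mathrm{id}\times r)(r\times \mathrm{id})(\mathrm{id}\times r)$ on $X^3$, $r^2=\mathrm{id}$ (involutive), and all maps $\sigma_x,\tau_y:X\to X$ are bijections (non-degenerate). Two solutions $(X,r)$, $(X',r')$ are isomorphic if there is a bijection $f:X\to X'$ with $r'(f\times f)=(f\times f)r$. The permutation group $\mathcal{G}(X,r)$ is the subgroup of $\mathrm{Sym}(X)$ generated by all $\sigma_x$; $(X,r)$ is indecomposable if this group acts transitively on $X$. A finite group is minimal non-cyclic if it is not cyclic and all its proper subgroups are cyclic. For an odd prime $p$ the unique minimal non-cyclic group of order $4p$ is the semidirect product $\mathbb{Z}/p\mathbb{Z}\rtimes\mathbb{Z}/4\mathbb{Z}$ in which a generator of $\mathbb{Z}/4\mathbb{Z}$ acts by inversion. *)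

(* Defs.v *)
From mathcomp Require Import all_boot all_fingroup all_solvable.
Set Implicit Arguments.
Unset Strict Implicit.
Unset Printing Implicit Defensive.

Section Maps.
Variables (X : Type) (r : X * X -> X * X).

(* r (x, y) = (sigma_x y, tau_y x) *)
Definition sigma_of (x y : X) : X := (r (x, y)).1.
Definition tau_of (y x : X) : X := (r (x, y)).2.

(* r x id and id x r, with X^3 encoded as X * X * X = (X * X) * X *)
Definition r_id (t : X * X * X) : X * X * X :=
  let: (x, y, z) := t in let: (x', y') := r (x, y) in (x', y', z).
Definition id_r (t : X * X * X) : X * X * X :=
  let: (x, y, z) := t in let: (y', z') := r (y, z) in (x, y', z').

End Maps.

Record solution := Solution {
  carrier :> Type;
  sol_map : carrier * carrier -> carrier * carrier;
  sol_inhabited : inhabited carrier;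
  sol_braid : r_id sol_map \o id_r sol_map \o r_id sol_map
           =1 id_r sol_map \o r_id sol_map \o id_r sol_map;
  sol_involutive : involutive sol_map;
  sol_sigma_bij : forall x, bijective (sigma_of sol_map x);
  sol_tau_bij : forall y, bijective (tau_of sol_map y)
}.

Definition solution_iso (S S' : solution) : Prop :=
  exists2 f : S -> S', bijective f &
    forall x y : S,
      sol_map (f x, f y) = (f (sol_map (x, y)).1, f (sol_map (x, y)).2).

(* The carrier is an arbitrary (possibly infinite) type, so the subgroup of
   Sym(X) generated by the sigma_x is given as a predicate on maps X -> X;
   [perm_group_inv] is closure under (two-sided) inverses. *)
Inductive perm_group (S : solution) : (S -> S) -> Prop :=
| perm_group_gen x : perm_group (sigma_of (@sol_map S) x)
| perm_group_id : perm_group id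
| perm_group_comp f g : perm_group f -> perm_group g -> perm_group (f \o g)
| perm_group_inv f g :
    perm_group f -> cancel f g -> cancel g f -> perm_group g.

Definition indecomposable (S : solution) : Prop :=
  forall x y : S, exists2 f : S -> S, perm_group f & f x = y.

(* G(X, r) is isomorphic to the finite group G: phi restricts to a group
   isomorphism from G onto G(X, r). *)
Definition perm_group_isog (S : solution) (gT : finGroupType)
    (G : {group gT}) : Prop :=
  exists phi : gT -> S -> S,
    [/\ {in G &, forall g h, phi (g * h)%g =1 phi g \o phi h},
        {in G &, forall g h, phi g =1 phi h -> g = h}
      & forall f : S -> S, perm_group f <-> exists2 g, g \in G & phi g =1 f].

Definition minimal_non_cyclic (gT : finGroupType) (G : {group gT}) : Prop :=
  ~~ cyclic G /\ forall H : {group gT}, H \proper G -> cyclic H.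

Definition perm_group_mnc (n : nat) (S : solution) : Prop :=
  exists (gT : finGroupType) (G : {group gT}),
    [/\ minimal_non_cyclic G, #|G| = n & perm_group_isog S G].

Definition exactly_two_up_to_iso (P : solution -> Prop) : Prop :=
  exists S1 S2 : solution,
    [/\ P S1, P S2, ~ solution_iso S1 S2
      & forall S, P S -> solution_iso S S1 \/ solution_iso S S2].

(* Main.v *)
Require Import Defs.
From mathcomp Require Import all_boot all_fingroup all_solvable.
From HB Require Import structures.
From mathcomp Require Import all_algebra.
From Stdlib Require Import IndefiniteDescription.

(** Why the theorem holds.  Let [G] be the minimal non-cyclic group of order
    [4 p].  A non-trivial subgroup of [G] contains the subgroup of order [p] or
    the central involution, so a point stabiliser, being core-free, is trivial
    and [G] acts regularly on [X] (lemmas [phi_free] and [dic_core]).  Choosing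
    a base point identifies [X] with [G], every [sigma_x] with the right
    multiplication by some [s x], and the braid equation with the symmetry in
    [g, h] of [s (h * (s g)^-1) * s g], a map [s] with this property being
    called a cycle map below.  The problem becomes the classification of the
    generating cycle maps on [G], up to automorphisms and base points.

    The group [G] itself is pinned down by [mnc_generators]: in the regular
    representation an element of order 4 is an odd permutation, so [G] has a
    subgroup of index 2, which is cyclic; its subgroup of order [p] is normal,
    and an element of order 4 can only act on it by inversion.

    The classification uses the additive group of the associated brace,
    realised inside [Sym(G)]: the permutations [t_x : g |-> s (x g^-1) g]
    commute pairwise and generate an abelian regular group [A], which the right
    multiplications of [G] normalise since they permute the [t_x].  Let [P] be
    the normal subgroup of order [p].  The Sylow [p]-subgroup of [A] has the
    same orbits as [P], and [P] centralises it because together they form a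
    group of order at most [p ^ 2]; [P] also centralises the [p']-part of [A],
    since a commutator lies in that part and fixes every block [P g].  A regular
    abelian group is its own centraliser, so the right multiplications by [P]
    lie in [A].  Hence [s] factors through [G / P] and splits as
    [s x = q x * z x] with [z x] in [P], [z (x h) = (z x)^h], and [q x] in a
    fixed complement [Q] of [P] (theorem [cocycle_split]).

    Only the cycle map induced on [G / P], which is cyclic of order 4, is left
    to determine.  After moving the base point so that [s 1] has order 4 modulo
    [P], a finite computation leaves two cases: the induced map is constant or
    alternates between an element and its inverse.  The elements [z 1] and
    [q 1] are then standard generators of [G], and the automorphism that they
    define carries [s] to [(i, k) |-> ((-1)^k, 1)] or to
    [(i, k) |-> ((-1)^k, (-1)^k)].  These two solutions are not isomorphic:
    in the second one only, the [p]-th power of some product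
    [sigma_x sigma_y] has a fixed point. *)

Set Implicit Arguments.
Unset Strict Implicit.
Unset Printing Implicit Defensive.

(** * Involutive solutions *)

Section SolutionTheory.
Variable S : solution.
Notation sig := (sigma_of (@sol_map S)).
Notation tau := (tau_of (@sol_map S)).

Lemma sol_map_pair x y : sol_map (x, y) = (sig x y, tau y x).
Proof. by rewrite /sigma_of /tau_of -surjective_pairing. Qed.

Lemma sigma_tau x y : sig (sig x y) (tau y x) = x.
Proof. by have := @sol_involutive S (x, y); rewrite !sol_map_pair => -[]. Qed.

Lemma tauP (x y t : S) : sig (sig x y) t = x -> tau y x = t.
Proof.
move=> E; have [g gK _] := @sol_sigma_bij S (sig x y).
by apply: (can_inj gK); rewrite E sigma_tau.
Qed.

(** First component of the braid equation, where [tau] has been eliminated: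
    this is the cycle set identity. *)
Lemma sol_sigma_comp (x y a b : S) : sig x y = a -> sig a b = x ->
  sig x \o sig y =1 sig a \o sig b.
Proof.
move=> <- /tauP <- z; have := congr1 (fun t => t.1.1) (@sol_braid S (x, y, z)).
by rewrite /= !sol_map_pair /= !sol_map_pair /= !sol_map_pair.
Qed.

(** This is the injectivity of [x |-> sigma_x^-1 x].  By involutivity,
    [sigma_x y = x] forces [r (x, y) = (x, y)], hence [tau_y x = y]; the points
    [x] and [x'] have therefore the same image under the bijection [tau_y]. *)
Lemma sol_diag_inj (x x' y : S) : sig x y = x -> sig x' y = x' -> x = x'.
Proof.
have fix_tau z : sig z y = z -> tau y z = y by move=> E; apply: tauP; rewrite E.
move=> /fix_tau E /fix_tau E'; have [g gK _] := @sol_tau_bij S y.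
by apply: (can_inj gK); rewrite E E'.
Qed.

End SolutionTheory.

(** An involutive solution is determined by its maps [sigma_x], so it is
    enough that a bijection respects these. *)
Lemma solution_iso_of_sigma (S S' : solution) (f : S' -> S) : bijective f ->
  (forall x y,
     f (sigma_of (@sol_map S') x y) = sigma_of (@sol_map S) (f x) (f y)) ->
  solution_iso S S'.
Proof.
move=> [g fK gK] fM; exists g => [|x y]; first by exists f.
have gM u v : g (sigma_of (@sol_map S) u v) = sigma_of (@sol_map S') (g u) (g v).
  by apply: (can_inj fK); rewrite fM !gK.
rewrite !sol_map_pair /= gM; congr pair.
by apply: tauP; rewrite -!gM sigma_tau.
Qed.

(** [perm_group] is closed under inverses given by two-sided cancellation, so
    inverting twice makes it closed under pointwise equality. *)
Lemma perm_group_ext (S : solution) (f g : S -> S) :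
  bijective f -> f =1 g -> perm_group f -> perm_group g.
Proof.
move=> [h fK hK] fg pf; have ph := perm_group_inv pf fK hK.
by apply: perm_group_inv ph _ _ => x; rewrite -fg.
Qed.

Section Transport.
Local Open Scope group_scope.

Lemma perm_group_isog_inj (S : solution) (gT hT : finGroupType) (G : {group gT})
    (f : hT -> gT) :
  injective f -> {morph f : x y / x * y} -> f @: setT = G ->
  perm_group_isog S G -> perm_group_isog S [set: hT].
Proof.
move=> f_inj fM fG [phi [phiM phi_inj phiP]].
have fin x : f x \in G by rewrite -fG imset_f.
exists (fun x => phi (f x)); split=> [x y _ _|x y _ _ E|h].
- by rewrite fM; apply: phiM.
- by apply: f_inj; apply: phi_inj.
split=> [/phiP[g]|[x _ E]]; last by apply/phiP; exists (f x).
by rewrite -fG => /imsetP[x _ ->] E; exists x.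
Qed.

End Transport.

(** * Cycle maps on finite groups *)

Section GroupSolution.
Local Open Scope group_scope.

(** The cycle set identity for [sigma_g := (fun h => h * s g)]. *)
Definition cycle_law (gT : finGroupType) (s : gT -> gT) :=
  forall g h, s (h * (s g)^-1) * s g = s (g * (s h)^-1) * s h.

Definition diag (gT : finGroupType) (s : gT -> gT) (x : gT) := x * (s x)^-1.

Variables (gT : finGroupType) (s : gT -> gT).
Hypotheses (s_cyc : cycle_law s) (s_diag : injective (diag s)).

Definition gsol_map (xy : gT * gT) : gT * gT :=
  (xy.2 * s xy.1, xy.1 * (s (xy.2 * s xy.1))^-1).

Lemma gsol_braid : r_id gsol_map \o id_r gsol_map \o r_id gsol_map
               =1 id_r gsol_map \o r_id gsol_map \o id_r gsol_map.
Proof.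
move=> [[x y] z]; rewrite /= /gsol_map /=.
set a := y * s x; set b := x * (s a)^-1; set v := z * s y; set w := v * s x.
have E1 : s b * s a = s y * s x by rewrite /b s_cyc /a mulgK.
have w_ba : z * s b * s a = w by rewrite -mulgA E1 mulgA.
have E2 : s (x * (s w)^-1) * s w = s v * s x by rewrite s_cyc /w mulgK.
have E3 : s (z * s b) * s a = s (a * (s w)^-1) * s w by rewrite s_cyc -w_ba mulgK.
have cd : y * (s v)^-1 * s (x * (s w)^-1) = a * (s w)^-1.
  apply: (canRL (mulgK _)); rewrite -mulgA E2 mulgA mulgKV //.
rewrite w_ba cd; congr (_, _, _).
by rewrite {1}/b -mulgA -invMg E3 invMg mulgA.
Qed.

Lemma gsol_involutive : involutive gsol_map.
Proof. by move=> [x y]; rewrite /gsol_map /= !mulgKV mulgK. Qed.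

Lemma gsol_sigma_bij x : bijective (sigma_of gsol_map x).
Proof. by apply: injF_bij => y z /mulIg. Qed.

(** Rump's argument: by the cycle set identity, [tau_y] followed by the
    diagonal map is the diagonal map followed by [sigma_y^-1]. *)
Lemma gsol_tau_bij y : bijective (tau_of gsol_map y).
Proof.
apply: injF_bij => x x'; rewrite /tau_of /= => E; apply: s_diag.
have diagE t : diag s (t * (s (y * s t))^-1) = diag s t * (s y)^-1.
  by rewrite /diag -!mulgA -!invMg s_cyc mulgK.
by apply: (mulIg (s y)^-1); rewrite -!diagE E.
Qed.

Definition gsol : solution :=
  @Solution gT gsol_map (inhabits 1) gsol_braid gsol_involutive
    gsol_sigma_bij gsol_tau_bij.

Lemma gsol_perm_group_mem (f : gsol -> gsol) :
  perm_group f -> exists2 g, g \in <<[set s x | x : gT]>> & f =1 mulg^~ g.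
Proof.
elim=> {f} [x||f g _ [u uS Ef] _ [v vS Eg]|f g _ [u uS Ef] fK gK].
- by exists (s x) => //; apply/mem_gen/imset_f.
- by exists 1 => // x; rewrite mulg1.
- by exists (v * u) => [|x]; rewrite ?groupM //= Ef Eg mulgA.
exists u^-1 => [|x]; first by rewrite groupV.
by rewrite -{2}[x]gK Ef mulgK.
Qed.

Lemma gsol_perm_group_mulg g :
  g \in <<[set s x | x : gT]>> -> @perm_group gsol (mulg^~ g).
Proof.
have bij h : bijective (mulg^~ h : gT -> gT) by apply/injF_bij/mulIg.
case/gen_prodgP=> n [c cP ->].
elim: n c cP => [|n IHn] c cP.
  rewrite big_ord0; apply: perm_group_ext (perm_group_id gsol); first by exists id.
  by move=> x /=; rewrite mulg1.
rewrite big_ord_recl; have /imsetP[y _ ->] := cP ord0.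
have := perm_group_comp (IHn _ (fun i => cP (lift ord0 i))) (@perm_group_gen gsol y).
apply: perm_group_ext => [|x]; last by rewrite /sigma_of /= mulgA.
by apply: bij_comp; [apply: bij | apply: gsol_sigma_bij].
Qed.

Hypothesis s_gen : <<[set s x | x : gT]>> = setT.

Lemma gsol_indecomposable : indecomposable gsol.
Proof.
move=> x y; exists (mulg^~ (x^-1 * y)); last by rewrite mulKVg.
by apply: gsol_perm_group_mulg; rewrite s_gen inE.
Qed.

Lemma gsol_perm_group_isog : perm_group_isog gsol [set: gT]%G.
Proof.
exists (fun g x => x * g^-1); split.
- by move=> g h _ _ x /=; rewrite invMg mulgA.
- by move=> g h _ _ /(_ 1); rewrite !mul1g => /invg_inj.
move=> f; split=> [/gsol_perm_group_mem[g _ Ef]|[g _ Ef]].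
  by exists g^-1; rewrite ?inE // => x; rewrite invgK Ef.
apply: perm_group_ext Ef _; first by apply/injF_bij/mulIg.
by apply: gsol_perm_group_mulg; rewrite s_gen inE.
Qed.

End GroupSolution.

(** * Indecomposable solutions with a regular permutation group *)

Section RegularAction.
Local Open Scope group_scope.
Variables (S : solution) (gT : finGroupType) (phi : gT -> S -> S).
Notation sig := (sigma_of (@sol_map S)).
Hypotheses (phiM : forall g h, phi (g * h) =1 phi g \o phi h)
  (phi_inj : forall g h, phi g =1 phi h -> g = h)
  (phiP : forall f, perm_group f <-> exists g, phi g =1 f).

Lemma phi1 : phi 1 =1 id.
Proof.
have /phiP[g gid] := perm_group_id S; suff <- : g = 1 by [].
apply: (mulgI g); rewrite mulg1.
by apply: phi_inj => x; rewrite phiM /= !gid.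
Qed.

Lemma phiVK g : cancel (phi g) (phi g^-1).
Proof. by move=> x; rewrite -[LHS]/((phi g^-1 \o phi g) x) -phiM mulVg phi1. Qed.

(** A faithful transitive action is free as soon as every non-trivial element
    has a non-trivial power that generates a normal subgroup: such a power of
    an element of a point stabiliser fixes all the points. *)
Lemma phi_free : indecomposable S ->
  (forall g : gT, g != 1 ->
     exists w, [/\ w \in <[g]>, w != 1 & forall h, w ^ h \in <[w]>]) ->
  forall x0 g, phi g x0 = x0 -> g = 1.
Proof.
move=> indec core x0 g gx0; apply/eqP/negPn/negP => /core[w [wg /negP w1 wN]].
have fixX h n : phi h x0 = x0 -> phi (h ^+ n) x0 = x0.
  by move=> E; elim: n => [|n IHn]; rewrite ?expg0 ?phi1 // expgS phiM /= IHn.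
have wx0 : phi w x0 = x0 by case/cycleP: wg => n ->; apply: fixX.
apply: w1; apply/eqP/phi_inj => y; rewrite phi1.
have [f /phiP[h hf] <-] := indec x0 y; rewrite -!hf.
rewrite -[LHS]/((phi w \o phi h) x0) -phiM conjgC phiM /=.
by have /cycleP[n ->] := wN h; rewrite fixX.
Qed.

Variable x0 : S.
Hypotheses (indec : indecomposable S) (free : forall g, phi g x0 = x0 -> g = 1).

(** The inverse turns the left action [phi] into a right action, for which
    [sigma] becomes a right multiplication. *)
Definition pt g := phi g^-1 x0.

Lemma pt_inj : injective pt.
Proof.
move=> g h E; apply/eqP; rewrite eq_mulgV1; apply/eqP/free.
by rewrite phiM /= -/(pt h) -E /pt -{1}[g]invgK phiVK.
Qed.

Lemma cycle_map_of_solution : exists s : gT -> gT,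
  [/\ forall g, phi (s g)^-1 =1 sig (pt g),
      cycle_law s, injective (diag s) & <<[set s g | g : gT]>> = setT].
Proof.
have ptM g h : pt (g * h) = phi h^-1 (pt g) by rewrite /pt invMg phiM.
have pt_surj x : exists g, pt g = x.
  have [f /phiP[h hf] <-] := indec x0 x; exists h^-1.
  by rewrite /pt invgK hf.
have ex g : exists c, phi c^-1 =1 sig (pt g).
  by have /phiP[c cE] := perm_group_gen (pt g); exists c^-1; rewrite invgK.
have [s sP] := fin_all_exists ex.
have sigpt g h : sig (pt g) (pt h) = pt (h * s g) by rewrite -sP ptM.
exists s; split=> //.
- move=> g h; apply: invg_inj; apply: phi_inj => x; rewrite !invMg !phiM /= !sP.
  by apply: (@sol_sigma_comp S _ _ _ _ _ _ x); rewrite sigpt mulgKV.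
- move=> g h E; apply: pt_inj; apply: (@sol_diag_inj S _ _ (pt (diag s g))).
    by rewrite sigpt mulgKV.
  by rewrite E sigpt mulgKV.
apply/setP=> g; rewrite inE.
suff gen f : perm_group f -> exists2 h, h \in <<[set s x | x : gT]>> & phi h^-1 =1 f.
  have /gen[h hs /phi_inj E] : perm_group (phi g) by apply/phiP; exists g.
  by rewrite -E groupV.
elim=> {f} [x||f h _ [u uS Ef] _ [v vS Eh]|f h _ [u uS Ef] fK hK].
- have [k <-] := pt_surj x; exists (s k) => //; exact/mem_gen/imset_f.
- by exists 1 => // x; rewrite invg1 phi1.
- by exists (v * u) => [|x]; rewrite ?groupM // invMg phiM /= Ef Eh.
exists u^-1 => [|x]; first by rewrite groupV.
by rewrite invgK -{1}[x]hK -Ef -{1}[u]invgK phiVK.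
Qed.

End RegularAction.

(** * The abelian regular group of a cycle map *)

Section Translations.
Local Open Scope group_scope.
Variables (gT : finGroupType) (s : gT -> gT).
Hypotheses (s_cyc : cycle_law s) (s_diag : injective (diag s)).

(** The translation by [s x] in the additive group of the brace, written
    without reference to the addition. *)
Definition trl_fun (x g : gT) : gT := s (x * g^-1) * g.

Lemma trl_fun_inj x : injective (trl_fun x).
Proof.
have trl_funE g : trl_fun x g = (diag s (x * g^-1))^-1 * x.
  by rewrite /diag invMg invgK invMg invgK !mulgA mulgKV.
move=> g h; rewrite !trl_funE => /mulIg/invg_inj/s_diag/mulgI; exact: invg_inj.
Qed.

Definition trl x : {perm gT} := perm (@trl_fun_inj x).
Definition rtr h : {perm gT} := perm (@mulIg gT h).

Lemma rtrE h g : rtr h g = g * h. Proof. by rewrite permE. Qed.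
Lemma trlE x g : trl x g = s (x * g^-1) * g. Proof. by rewrite permE. Qed.

Lemma rtrM : {in setT &, {morph rtr : g h / g * h}}.
Proof. by move=> g h _ _; apply/permP=> x; rewrite permM !rtrE mulgA. Qed.
Canonical rtr_morphism := Morphism rtrM.

Lemma rtr_inj : injective rtr.
Proof. by move=> g h /permP/(_ 1); rewrite !rtrE !mul1g. Qed.

(** This is the cycle set identity, up to a right multiplication. *)
Lemma trl_commute x y : commute (trl x) (trl y).
Proof.
apply/permP=> g; rewrite !permM !trlE !invMg !mulgA; congr (_ * g).
exact: s_cyc.
Qed.

Lemma trlJ x h : trl x ^ rtr h = trl (x * h).
Proof.
apply/permP=> g; rewrite -{1}(mulgKV h g) -rtrE permJ rtrE !trlE.
by rewrite invMg invgK !mulgA mulgKV.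
Qed.

Definition trl_group := <<[set trl x | x : gT]>>.

Lemma mem_trl x : trl x \in trl_group.
Proof. exact/mem_gen/imset_f. Qed.

Lemma trl_group_abelian : abelian trl_group.
Proof.
rewrite abelian_gen; apply/centsP=> _ /imsetP[x _ ->] _ /imsetP[y _ ->].
exact: trl_commute.
Qed.

Lemma rtr_norm_trl_group h : rtr h \in 'N(trl_group).
Proof.
rewrite inE -genJ gen_subG; apply/subsetP=> _ /imsetP[_ /imsetP[x _ ->] ->].
by rewrite trlJ mem_trl.
Qed.

Hypothesis s_gen : <<[set s x | x : gT]>> = setT.

(** From [g], the translations reach [s y * g] for every [y], and these left
    multiplications generate the whole group. *)
Lemma trl_group_trans g : exists2 a, a \in trl_group & a 1 = g.
Proof.
have: g \in <<[set s x | x : gT]>> by rewrite s_gen inE.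
case/gen_prodgP=> n [c cP ->].
elim: n c cP => [|n IHn] c cP; first by exists 1; rewrite ?group1 // perm1 big_ord0.
have [a aA a1] := IHn _ (fun i => cP (lift ord0 i)).
have /imsetP[y _ cy] := cP ord0.
exists (a * trl (y * a 1)); first by rewrite groupM // mem_trl.
by rewrite permM trlE mulgK big_ord_recl -cy a1.
Qed.

Lemma trl_group_semireg a c :
  a \in trl_group -> c \in 'C(trl_group) -> a 1 = c 1 -> a = c.
Proof.
move=> aA cA ac; apply/permP=> g; have [d dA <-] := trl_group_trans g.
have ca: commute c d := centP cA d dA.
have ad: commute a d := centsP trl_group_abelian a aA d dA.
by rewrite -!permM -ad -ca !permM ac.
Qed.

Lemma trl_group_inj a c :
  a \in trl_group -> c \in trl_group -> a 1 = c 1 -> a = c.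
Proof.
move=> aA cA; apply: trl_group_semireg => //.
exact: (subsetP trl_group_abelian).
Qed.

Definition orb1 (B : {set {perm gT}}) : {set gT} := [set (a : {perm gT}) 1 | a in B].

Lemma card_orb1 (B : {set {perm gT}}) : B \subset trl_group -> #|orb1 B| = #|B|.
Proof.
move=> /subsetP sBA; apply: card_in_imset => a c /sBA aA /sBA cA; exact: trl_group_inj.
Qed.

Lemma card_trl_group : #|trl_group| = #|[set: gT]|.
Proof.
rewrite -(card_orb1 (subxx _)); congr #|pred_of_set _|; apply/setP=> g; rewrite inE.
by have [a aA <-] := trl_group_trans g; apply: imset_f.
Qed.

Section Normalised.
Variable B : {group {perm gT}}.
Hypotheses (sBA : B \subset trl_group) (nB : forall h, rtr h \in 'N(B)).

Lemma orb1_shift a g : a \in B -> exists2 c, c \in B & c g = a 1 * g.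
Proof.
move=> aB; exists (a ^ rtr g); first by rewrite memJ_norm.
by rewrite -{2}(mul1g g) -[1 * g]rtrE permJ rtrE.
Qed.

(** Evaluation at 1 is a bijective 1-cocycle from the group of translations,
    so it maps invariant subgroups to subgroups. *)
Lemma orb1_group_set : group_set (orb1 B).
Proof.
apply/group_setP; split; first by apply/imsetP; exists 1; rewrite ?perm1.
move=> _ _ /imsetP[a aB ->] /imsetP[c cB ->].
have [d dB <-] := orb1_shift (c 1) aB.
by apply/imsetP; exists (c * d); rewrite ?groupM ?permM.
Qed.
Canonical orb1_group := Group orb1_group_set.
End Normalised.

Section PrimeSylow.
Variables (p : nat) (P : {group gT}).
Hypotheses (p_pr : prime p) (sylP : p.-Sylow([set: gT]) P).
Hypotheses (nP : P <| setT) (oP : #|P| = p).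

Let B := 'O_p(trl_group).
Let C := 'O_p^'(trl_group).

Let nil : nilpotent trl_group. Proof. exact: abelian_nil trl_group_abelian. Qed.
Let sBA : B \subset trl_group. Proof. exact: pcore_sub. Qed.
Let sCA : C \subset trl_group. Proof. exact: pcore_sub. Qed.
Let nB h : rtr h \in 'N(B).
Proof. exact: subsetP (char_norms (pcore_char _ _)) _ (rtr_norm_trl_group h). Qed.
Let nC h : rtr h \in 'N(C).
Proof. exact: subsetP (char_norms (pcore_char _ _)) _ (rtr_norm_trl_group h). Qed.

Let oB : #|B| = p.
Proof.
by rewrite (card_Hall (nilpotent_pcore_Hall p nil)) card_trl_group -(card_Hall sylP).
Qed.

Lemma orb1_pcore : orb1 B = P.
Proof.
apply/eqP; rewrite eqEcard card_orb1 // oB oP leqnn andbT.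
change (orb1 B) with (orb1_group nB : {set gT}).
rewrite (sub_normal_Hall sylP) ?subsetT //.
by rewrite /pgroup /= card_orb1 // oB pnat_id.
Qed.

Lemma tiBC a : a \in B -> a \in C -> a = 1.
Proof.
have [_ _ _ ti] := dprodP (nilpotent_pcoreC p nil).
move=> aB aC; have: a \in 'O_p(trl_group) :&: 'O_p^'(trl_group) by rewrite inE aB.
by rewrite ti => /set1P.
Qed.

(** The [p]-core of the translation group and the right multiplications by [P]
    form together a group of order dividing [p ^ 2], hence abelian. *)
Lemma rtr_cent_pcore : rtr @* P \subset 'C(B).
Proof.
have nPB : rtr @* P \subset 'N(B).
  by apply/subsetP=> _ /morphimP[z _ _ ->].
have oRP: #|rtr @* P| = p.
  by rewrite -oP card_injm ?subsetT //; apply/injmP=> g h _ _; apply: rtr_inj.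
have dv: #|B <*> rtr @* P| %| p ^ 2.
  rewrite norm_joinEr //; have := mul_cardG [group of B] (rtr @* P)%G.
  by rewrite oB /= oRP mulnn => ->; apply: dvdn_mulr.
have: abelian (B <*> rtr @* P).
  apply: (@p2group_abelian _ p).
    by apply: pnat_dvd dv _; rewrite pnatX pnat_id.
  by rewrite -(pfactorK 2 p_pr) dvdn_leq_log // expn_gt0 prime_gt0.
move/centsP=> cc; apply/centsP=> x xP y yB; apply: cc.
  by apply: subsetP (joing_subr _ _) _ xP.
by apply: subsetP (joing_subl _ _) _ yB.
Qed.

(** The [p]-core and the right multiplications by [P] have the same orbits, the
    cosets of [P].  A commutator of such a multiplication with an element of
    the [p']-core therefore moves 1 inside [P], as an element of the [p]-core
    does; it also lies in the [p']-core, hence is trivial. *)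
Lemma rtr_cent_pcoreC : rtr @* P \subset 'C(C).
Proof.
apply/centsP=> _ /morphimP[z _ zP ->] c cC; apply/commute_sym/commgP.
have dC : [~ c, rtr z] \in C by rewrite commgEl groupM ?groupV ?memJ_norm.
apply/eqP/tiBC => //.
suff: [~ c, rtr z] 1 \in P.
  rewrite -orb1_pcore => /imsetP[d dB Ed].
  by rewrite (trl_group_inj (subsetP sCA _ dC) (subsetP sBA _ dB) Ed).
rewrite commgEl permM -[in X in X \in _](mulgKV z (c^-1 1)) -rtrE permJ rtrE groupM //.
set y := c^-1 1; have yzP: y * z^-1 * y^-1 \in P.
  have ->: y * z^-1 * y^-1 = z^-1 ^ y^-1 by rewrite conjgE invgK mulgA.
  by rewrite memJ_norm ?groupV // (subsetP (normal_norm nP)) ?inE.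
have: y * z^-1 * y^-1 \in orb1 B by rewrite orb1_pcore.
case/imsetP=> b bB Eb; have [d dB Ed] := orb1_shift nB y bB.
rewrite -[y * z^-1](mulgKV y) Eb -Ed -permM.
have dc: commute d c.
  exact: (centsP trl_group_abelian _ (subsetP sBA _ dB) _ (subsetP sCA _ cC)).
by rewrite dc permM permKV -orb1_pcore imset_f.
Qed.

(** Centralising both parts of the translation group, the right multiplications
    by [P] belong to it, because a regular abelian group is its own centraliser. *)
Lemma rtr_pcore z : z \in P -> rtr z \in B.
Proof.
move=> zP; have rz : rtr z \in rtr @* P by apply: mem_morphim; rewrite ?inE.
have BC : B * C = trl_group by case: (dprodP (nilpotent_pcoreC p nil)).
have rC : rtr z \in 'C(trl_group).
  by rewrite -BC centM inE (subsetP rtr_cent_pcore) // (subsetP rtr_cent_pcoreC).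
have: z \in orb1 B by rewrite orb1_pcore.
case/imsetP=> b bB Eb; rewrite -(@trl_group_semireg b (rtr z)) ?(subsetP sBA) //.
by rewrite rtrE mul1g Eb.
Qed.

Lemma cycle_map_coset x w : w \in P -> s (x * w) = s x.
Proof.
move=> wP; have cw : commute (trl x) (rtr w).
  by apply: (centsP trl_group_abelian); rewrite ?mem_trl ?(subsetP sBA) ?rtr_pcore.
have: trl (x * w) 1 = trl x 1 by rewrite -trlJ /conjg cw mulKg.
by rewrite !trlE invg1 !mulg1.
Qed.

(** Decompose the translation [t_x] into its [p]-part, which is the right
    multiplication by some [z x] in [P], and its [p']-part, whose value at 1
    is [q x]. *)
Theorem cocycle_split : exists (Q : {group gT}) (q z : gT -> gT),
  [/\ P :&: Q = 1, forall x, q x \in Q, forall x, z x \in P,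
      forall x, s x = q x * z x &
      forall x h, z (x * h) = z x ^ h].
Proof.
exists (orb1_group nC).
have ex x : exists zq : gT * {perm gT},
    [/\ zq.1 \in P, zq.2 \in C & trl x = zq.2 * rtr zq.1].
  have [_ BC cBC _] := dprodP (nilpotent_pcoreC p nil).
  have: trl x \in B * C by rewrite BC mem_trl.
  case/mulsgP=> b c bB cC Ex.
  have b1P : b 1 \in P by rewrite -orb1_pcore imset_f.
  exists (b 1, c); split=> //=.
  have Eb: b = rtr (b 1).
    apply: (trl_group_inj (subsetP sBA _ bB) (subsetP sBA _ (rtr_pcore b1P))).
    by rewrite rtrE mul1g.
  by rewrite Ex -Eb; apply/esym/(centsP cBC).
have [f fP] := fin_all_exists ex.
have fE x : trl x = (f x).2 * rtr (f x).1 by case: (fP x).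
have zP x : (f x).1 \in P by case: (fP x).
have cC x : (f x).2 \in C by case: (fP x).
exists (fun x => (f x).2 1), (fun x => (f x).1); split=> //.
- apply/trivgP/subsetP=> x /setIP[xP /imsetP[c cC' Ex]]; apply/set1P.
  have: rtr x = c.
    apply: (trl_group_inj (subsetP sBA _ (rtr_pcore xP)) (subsetP sCA _ cC')).
    by rewrite rtrE mul1g.
  move=> Ec; have := tiBC (rtr_pcore xP); rewrite Ec => /(_ cC') c1.
  by rewrite Ex c1 perm1.
- by move=> x; apply: imset_f.
- by move=> x; rewrite -rtrE -permM -fE trlE invg1 !mulg1.
move=> x h; have := trlJ x h; rewrite !fE conjMg => E.
have rJ: rtr (f x).1 ^ rtr h = rtr ((f x).1 ^ h) by rewrite -morphJ ?inE.
have xhP : (f x).1 ^ h \in P by rewrite memJ_norm // (subsetP (normal_norm nP)) ?inE.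
rewrite rJ in E.
have: (f (x * h)).2^-1 * (f x).2 ^ rtr h = rtr (f (x * h)).1 * (rtr ((f x).1 ^ h))^-1.
  by apply: (canRL (mulgK _)); rewrite -mulgA E mulKg.
move=> E'; apply: rtr_inj; apply/eqP; rewrite eq_mulgV1 -E'; apply/eqP/tiBC.
  by rewrite E' groupM ?groupV ?rtr_pcore.
by rewrite groupM ?groupV ?memJ_norm.
Qed.

End PrimeSylow.
End Translations.

(** * The dicyclic group of order 4p *)

(** The pair [(i, k)] stands for the product [b ^ k * u ^ i] in the semidirect
    product of [<[u]>] of order [p] by [<[b]>] of order 4, where [b] inverts
    [u].  The alias hides the group structure of the direct product. *)
Definition dic (p : nat) : Type := ('F_p * 'Z_4)%type.
HB.instance Definition _ p := Finite.on (dic p).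

Section Dicyclic.
Import GRing.Theory.
Local Open Scope ring_scope.
Variable p : nat.

Definition sgn (k : 'Z_4) : 'F_p := (-1) ^+ k.

Lemma sgnD k l : sgn (k + l) = sgn k * sgn l.
Proof. by rewrite /sgn -exprD -signr_odd /= odd_mod // signr_odd. Qed.

Lemma sgnN k : sgn (- k) = sgn k.
Proof.
by rewrite /sgn -signr_odd /= odd_mod // oddB ?signr_odd // ltnW.
Qed.

Lemma sgn2 k : sgn k * sgn k = 1.
Proof. by rewrite -expr2 sqrr_sign. Qed.

Lemma sgn0 : sgn 0 = 1. Proof. exact: expr0. Qed.
Lemma sgn1 : sgn 1 = -1. Proof. exact: expr1. Qed.

Definition dic_mul (x y : dic p) : dic p := (sgn y.2 * x.1 + y.1, x.2 + y.2).
Definition dic_inv (x : dic p) : dic p := (- (sgn x.2 * x.1), - x.2).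

Lemma dic_mulA : associative dic_mul.
Proof.
by move=> x y z; rewrite /dic_mul /= sgnD mulrDr !addrA -mulrA mulrCA.
Qed.

Lemma dic_mul1 : left_id ((0, 0) : dic p) dic_mul.
Proof. by case=> i k; rewrite /dic_mul /= mulr0 !add0r. Qed.

Lemma dic_mulV : left_inverse ((0, 0) : dic p) dic_inv dic_mul.
Proof.
by case=> i k; rewrite /dic_mul /= mulrN mulrA sgn2 mul1r !addNr.
Qed.

HB.instance Definition _ :=
  Finite_isGroup.Build (dic p) dic_mulA dic_mul1 dic_mulV.

Lemma dicM (x y : dic p) : (x * y)%g = (sgn y.2 * x.1 + y.1, x.2 + y.2) :> dic p.
Proof. by []. Qed.

Lemma dicV (x : dic p) : (x^-1)%g = (- (sgn x.2 * x.1), - x.2) :> dic p.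
Proof. by []. Qed.

Lemma dic1 : 1%g = (0, 0) :> dic p.
Proof. by []. Qed.

Lemma dic_projM (x y : dic p) : (x * y)%g.2 = x.2 + y.2.
Proof. by []. Qed.

Lemma dic_projV (x : dic p) : (x^-1)%g.2 = (- x.2)%R.
Proof. by []. Qed.

End Dicyclic.

Section DicyclicMap.
Import GRing.Theory.
Local Open Scope group_scope.
Variable p : nat.
Hypothesis p_pr : prime p.

Lemma sgn_odd (k : 'Z_4) : sgn p k = (if odd k then - 1 else 1)%R.
Proof. by rewrite /sgn -signr_odd; case: (odd k). Qed.

Lemma card_dic : #|[set: dic p]| = (4 * p)%N.
Proof. by rewrite cardsT card_prod card_Fp // card_ord mulnC. Qed.

Lemma dic_proj_expg (x : dic p) n : ((x ^+ n)%g.2 = x.2 *+ n)%R.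
Proof. by elim: n => [|n IHn]; rewrite ?expg0 // expgS dicM IHn mulrS. Qed.

Lemma dic_expg0 (i : 'F_p) n : (((i, 0%R) : dic p) ^+ n = (i *+ n, 0)%R :> dic p)%g.
Proof.
elim: n => [|n IHn]; first by rewrite expg0 mulr0n.
by rewrite expgS IHn dicM /= /sgn expr0 mul1r addr0 mulrS.
Qed.

Variables (gT : finGroupType) (u b : gT).
Hypotheses (up1 : u ^+ p = 1) (b41 : b ^+ 4 = 1) (ub : u ^ b = u^-1).

Definition dic_map (x : dic p) : gT := b ^+ x.2 * u ^+ x.1.

Lemma expg_FpD (i j : 'F_p) : u ^+ (i + j)%R = u ^+ i * u ^+ j.
Proof.
rewrite -expgD -(expg_mod (i + j) up1) /=; congr (u ^+ (_ %% _)).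
exact: Fp_cast.
Qed.

Lemma expg_FpN (i : 'F_p) : u ^+ (- i)%R = (u ^+ i)^-1.
Proof. by apply/eqP; rewrite eq_sym eq_invg_mul -expg_FpD subrr. Qed.

Lemma expg_Fp_sgn (i : 'F_p) (k : 'Z_4) : (u ^+ i) ^ (b ^+ k) = u ^+ (sgn p k * i)%R.
Proof.
rewrite /sgn; elim: (nat_of_ord k) i => [|n IHn] i; first by rewrite conjg1 mul1r.
rewrite expgS conjgM conjXg ub expgVn -expg_FpN IHn exprS mulN1r.
by rewrite mulrN mulNr.
Qed.

Lemma dic_mapM : {morph dic_map : x y / x * y}.
Proof.
move=> x y; rewrite /dic_map.
have ->: u ^+ (x * y).1 = (u ^+ x.1) ^ (b ^+ y.2) * u ^+ y.1.
  by rewrite expg_Fp_sgn -expg_FpD.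
have ->: b ^+ (x * y).2 = b ^+ x.2 * b ^+ y.2.
  by rewrite -expgD -(expg_mod (x.2 + y.2) b41).
by rewrite /conjg !mulgA mulgK.
Qed.

Lemma dic_map_inj : u != 1 -> b ^+ 2 != 1 -> p <> 2 -> injective dic_map.
Proof.
move=> u1 b21 p2.
have ou : #[u] = p by apply: nt_prime_order.
have ob : #[b] = 4.
  have: #[b] %| 4 by rewrite order_dvdn b41.
  have: ~~ (#[b] %| 2) by rewrite order_dvdn.
  by case: #[b] => [|[|[|[|[|]]]]] // n _ /dvdn_leq; rewrite !ltnS ltn0 => /(_ isT).
have ti : <[b]> :&: <[u]> = 1.
  apply: coprime_TIg; rewrite -!orderE ou ob (@coprimeXl 2 2) //.
  by rewrite prime_coprime // dvdn_prime2 // eq_sym; apply/eqP.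
have inj1 x : dic_map x = 1 -> x = 1.
  move/eqP; rewrite /dic_map -eq_invg_mul => /eqP E.
  have bu : u ^+ x.1 \in <[b]> :&: <[u]> by rewrite inE mem_cycle -E groupV mem_cycle.
  have u0 : u ^+ x.1 = 1 by move: bu; rewrite ti => /set1P.
  have b0 : b ^+ x.2 = 1 by apply/eqP; rewrite -eq_invg1 E u0.
  have small (n m : nat) : m < n -> n %| m -> m = 0.
    by move=> ltmn /dvdnP[[|k] // E']; move: ltmn; rewrite E' mulSn ltnNge leq_addr.
  have x1 : x.1 = 0%R.
    apply/val_inj/(small p); first by apply: leq_trans (ltn_ord _) _; rewrite Fp_cast.
    by have := order_dvdn u x.1; rewrite ou u0 eqxx.
  have x2 : x.2 = 0%R.
    apply/val_inj/(small 4); first exact: (ltn_ord x.2).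
    by have := order_dvdn b x.2; rewrite ob b0 eqxx.
  by rewrite dic1 -x1 -x2; case: (x).
move=> x y E; apply/eqP; rewrite eq_mulgV1; apply/eqP/inj1.
have dV z : dic_map z^-1 = (dic_map z)^-1.
  apply/eqP; rewrite eq_sym eq_invg_mul -dic_mapM mulgV.
  by rewrite /dic_map dic1 !expg0 mulg1.
by rewrite dic_mapM dV E mulgV.
Qed.
End DicyclicMap.

(** * Minimal non-cyclic groups of order 4p *)

Section Minimal.
Local Open Scope group_scope.

Lemma porbits_rtr (gT : finGroupType) (b : gT) :
  porbits (rtr b) = lcosets <[b]> setT.
Proof.
have rX n x : (rtr b ^+ n) x = x * b ^+ n.
  by rewrite -(morphX (rtr_morphism gT)) ?inE //= rtrE.
apply/setP=> D; apply/imsetP/lcosetsP => -[x _ ->]; exists x => //;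
  apply/setP=> y; rewrite mem_lcoset.
  apply/porbitP/cycleP=> -[n E]; exists n.
    by rewrite E rX mulKg.
  by rewrite rX -E mulKVg.
apply/cycleP/porbitP=> -[n E]; exists n; last by rewrite E rX mulKg.
by rewrite rX -E mulKVg.
Qed.

(** The elements acting evenly in the regular representation form a subgroup
    of index 2. *)
Lemma odd_rtr_half (gT : finGroupType) (b : gT) : odd_perm (rtr b) ->
  exists N : {group gT}, (2 * #|N|)%N = #|[set: gT]|.
Proof.
move=> ob; have rM (x y : gT) : rtr (x * y) = rtr x * rtr y by rewrite rtrM ?inE.
have rtr1 : rtr (1 : gT) = 1 by apply: (morph1 (rtr_morphism gT)).
pose N := [set x : gT | ~~ odd_perm (rtr x)].
have gN : group_set N.
  apply/group_setP; split=> [|x y].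
    by rewrite inE rtr1 odd_perm1.
  by rewrite !inE rM odd_permM => /negbTE-> /negbTE->.
exists (Group gN) => /=; have NC : ~: N = N :* b.
  apply/setP=> x; rewrite mem_rcoset !inE negbK rM odd_permM.
  have -> : rtr b^-1 = (rtr b)^-1 by apply: (morphV (rtr_morphism gT)); rewrite inE.
  by rewrite odd_permV ob addbT negbK.
by rewrite cardsT -(cardsC N) NC card_rcoset mul2n addnn.
Qed.

(** An element of order 4 acts regularly as a product of [n] cycles of length
    4, which is an odd permutation. *)
Lemma half_subgroup (gT : finGroupType) (G : {group gT}) (b : gT) n :
  #|G| = (4 * n)%N -> odd n -> b \in G -> #[b] = 4 ->
  exists N : {group gT}, N \subset G /\ #|N| = (2 * n)%N.
Proof.
move=> oG n_odd bG ob.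
have oT : #|[set: subg_of G]| = (4 * n)%N by rewrite -oG -(card_isog (isog_subg G)).
have ob' : #[subg G b] = 4.
  have bE : sgval (subg G b) = b by apply: subgK.
  by rewrite -ob -{2}bE (order_injm (injm_sgval G)) ?inE.
have b_odd : odd_perm (rtr (subg G b)).
  rewrite /odd_perm porbits_rtr card_lcosets -divgS ?subsetT // -orderE ob' oT.
  by rewrite mulKn // n_odd -cardsT oT oddM.
have [N oN] := odd_rtr_half b_odd.
exists (sgval @* N)%G; split; first by apply/subsetP=> _ /morphimP[x _ _ ->]; apply: subgP.
rewrite card_injm ?injm_sgval ?subsetT //.
by apply/eqP; rewrite -(eqn_pmul2l (isT : 0 < 2)) oN oT mulnA.
Qed.

Lemma odd_prime_neq2 p : prime p -> p <> 2 -> odd p.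
Proof. by move=> p_pr p_neq2; have [/p_neq2|] := even_prime p_pr. Qed.

(** The subgroup of index 2 is cyclic, so its subgroup [<[u]>] of order [p] is
    normal.  The element [b ^+ 2] commutes with [u] since together they generate
    a proper subgroup, while [b] does not, since otherwise [u * b] would generate
    the group.  Hence [u * u ^ b], which [b] centralises, cannot generate
    [<[u]>], and is 1. *)
Lemma mnc_generators (gT : finGroupType) (G : {group gT}) p :
  prime p -> p <> 2 -> minimal_non_cyclic G -> #|G| = (4 * p)%N ->
  exists u b, [/\ u \in G, b \in G, #[u] = p, #[b] = 4 & u ^ b = u^-1].
Proof.
move=> p_pr p_neq2 [ncG mnc] oG; have p_odd := odd_prime_neq2 p_pr p_neq2.
have cop : coprime 4 p by rewrite (@coprimeXl 2 2) // coprime2n.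
have p0 := prime_gt0 p_pr; have p1 := prime_gt1 p_pr.
have cyc (H : {group gT}) : H \subset G -> #|H| < 4 * p -> cyclic H.
  by move=> sHG ltH; apply: mnc; rewrite properEcard sHG oG.
have [Q /and3P[sQG _ _] oQ] : exists2 Q : {group gT}, 2.-Sylow(G) Q & #|Q| = 4.
  have [Q sylQ] := Sylow_exists 2 G; exists Q => //.
  rewrite (card_Hall sylQ) oG partnM // (@part_pnat_id _ 4) // part_p'nat ?muln1 //.
  by rewrite p'natE // dvdn2 negbK.
have /cyclicP[b Eb] : cyclic Q by apply: cyc => //; rewrite oQ -{1}[4]muln1 ltn_pmul2l.
have ob : #[b] = 4 by rewrite orderE -Eb.
have bG : b \in G by rewrite (subsetP sQG) // Eb cycle_id.
have [N [sNG oN]] := half_subgroup oG p_odd bG ob.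
have nNG : N <| G.
  apply: index2_normal => //; rewrite -divgS // oG oN.
  by rewrite -(mulnA 2 2) mulnK // muln_gt0.
have cycN : cyclic N by apply: cyc => //; rewrite oN ltn_pmul2r.
have [u uN ou] : {u | u \in N & #[u] = p} by apply: Cauchy => //; rewrite oN dvdn_mull.
have nUG : <[u]> <| G.
  by apply: char_normal_trans nNG; rewrite sub_cyclic_char // cycle_subG.
have uG : u \in G := subsetP sNG u uN.
exists u, b; split=> //.
have ub : u ^ b \in <[u]> by rewrite memJ_norm ?cycle_id ?(subsetP (normal_norm nUG)).
have cuv : commute u (u ^ b) by apply: (centsP (cycle_abelian u)); rewrite ?cycle_id.
have cub2 : commute u (b ^+ 2).
  have nU : <[b ^+ 2]> \subset 'N(<[u]>).
    by rewrite cycle_subG (subsetP (normal_norm nUG)) // groupX.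
  have /cyclic_abelian/centsP cK : cyclic (<[u]> <*> <[b ^+ 2]>).
    apply: cyc; first by rewrite join_subG !cycle_subG uG groupX.
    have ob2 : #[b ^+ 2] = 2 by rewrite orderXdiv ob.
    rewrite /= norm_joinEr //; apply: (@leq_ltn_trans (p * 2)).
      have := mul_cardG <[u]> <[b ^+ 2]>; rewrite /= -!orderE ou ob2 => ->.
      by rewrite leq_pmulr ?cardG_gt0.
    by rewrite mulnC ltn_pmul2r.
  by apply: cK; rewrite ?mem_gen // inE cycle_id ?orbT.
pose w := u * u ^ b.
have wb : w ^ b = w.
  have ubb : (u ^ b) ^ b = u.
    by rewrite -conjgM; apply/conjg_fixP/commgP.
  by rewrite /w conjMg ubb cuv.
have wU : w \in <[u]> by rewrite groupM ?cycle_id.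
suff: w = 1 by move/eqP; rewrite -eq_invg_mul => /eqP.
apply/eqP/negPn/negP => w1.
have uw : u \in <[w]>.
  suff -> : <[w]> = <[u]> by apply: cycle_id.
  apply/eqP; rewrite eqEcard cycle_subG wU -!orderE ou.
  have wp : w ^+ p = 1 by apply/eqP; rewrite -order_dvdn -ou order_dvdG.
  by rewrite /= (nt_prime_order p_pr wp).
have cubG : commute u b.
  case/cycleP: uw => k ->; apply/commute_sym/commuteX/commute_sym.
  exact/commgP/conjg_fixP.
case/negP: ncG; apply/cyclicP; exists (u * b); apply/eqP.
rewrite eq_sym eqEcard cycle_subG groupM // -orderE.
by rewrite orderM // ou ob ?oG /= 1?mulnC // coprime_sym.
Qed.

End Minimal.

Section Structure.
Import GRing.Theory.
Local Open Scope ring_scope.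
Variable p : nat.
Hypotheses (p_pr : prime p) (p_neq2 : p <> 2%N).

Lemma Fp_2_neq0 : (1 + 1 : 'F_p) != 0.
Proof.
rewrite -[1 + 1]/(2%:R) -(dvdn_pcharf (pchar_Fp p_pr)) dvdn_prime2 //.
exact/eqP.
Qed.

(** An odd [k] satisfies [k * k = 1] modulo 4. *)
Lemma Z4_odd_gen (k l : 'Z_4) : odd k -> k *+ (l * k) = l.
Proof.
by case: k => [[|[|[|[|?]]]] //= ?]; case: l => [[|[|[|[|?]]]] //= ?] _; apply/val_inj.
Qed.

Lemma Z4_double_odd n : odd n -> ((1 + 1) *+ n : 'Z_4) = 1 + 1.
Proof.
move=> n_odd; rewrite -[n]odd_double_half n_odd add1n mulrS -muln2 mulnC mulrnA.
rewrite -[_ *+ 2]/((1 + 1 + (1 + 1)) : 'Z_4).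
have -> : (1 + 1 + (1 + 1)) = 0 :> 'Z_4 by apply/val_inj.
by rewrite mul0rn addr0.
Qed.

Local Open Scope group_scope.

Lemma dic_odd_proj (x y : dic p) : odd x.2 ->
  exists n, (x ^- n * y).2 = 0%R.
Proof.
move=> xo; exists (y.2 * x.2)%N.
by rewrite dicM dicV /= dic_proj_expg Z4_odd_gen // addNr.
Qed.

(** Such a subgroup contains the subgroup of order [p], which [w] generates, and
    the powers of [x] represent all its cosets. *)
Lemma dic_gen (H : {group dic p}) (x w : dic p) :
  x \in H -> odd x.2 -> w \in H -> w.2 = 0%R -> w != 1 -> H :=: setT.
Proof.
case: w => j k xH xo wH /= k0; rewrite k0 in wH * => w1.
have j0 : j != 0%R by apply: contra w1 => /eqP->.
have PH i : ((i, 0%R) : dic p) \in H.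
  rewrite -[i](mulVKf j0) -[(j^-1 * i)%R]natr_Zp mulr_natr -dic_expg0.
  exact: groupX.
apply/setP=> y; rewrite inE; have [n yn] := dic_odd_proj y xo.
rewrite -(groupMl y (groupVr (groupX n xH))).
by move: yn (PH (x ^- n * y).1); case: (_ * _) => a b /= ->.
Qed.

Lemma dic_even_cyclic : exists c : dic p, forall x : dic p, ~~ odd x.2 -> x \in <[c]>.
Proof.
exists ((1, 1 + 1)%R : dic p) => -[i k] /= ke.
have cX n : (((1, 1 + 1)%R : dic p) ^+ n = (n%:R, (1 + 1) *+ n)%R :> dic p).
  elim: n => [|n IHn]; first by rewrite expg0.
  rewrite expgSr IHn dicM /= -mulrSr; congr (_, _).
  by rewrite /sgn /= expr2 mulN1r opprK mul1r -natr1.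
(* The exponent has to be [i] modulo [p], and odd exactly when [k] is not 0:
   the number [i * p.+1] is even, and adding [p] changes its parity only. *)
suff [n ni nk]: exists2 n, (n%:R = i :> 'F_p)%R & ((1 + 1) *+ n = k :> 'Z_4)%R.
  by apply/cycleP; exists n; rewrite cX ni nk.
have p0 : (p%:R = 0 :> 'F_p)%R by apply: pchar_Fp_0.
have four m : ((1 + 1) *+ (m * p.+1) = 0 :> 'Z_4)%R.
  rewrite mulnC mulrnA mulrS Z4_double_odd ?odd_prime_neq2 //.
  have -> : (1 + 1 + (1 + 1))%R = 0%R :> 'Z_4 by apply/val_inj.
  by rewrite mul0rn.
have iE : ((i * p.+1)%N%:R = i :> 'F_p)%R by rewrite natrM -natr1 p0 add0r mulr1 natr_Zp.
have [->|k0] := eqVneq k 0%R; first by exists (i * p.+1)%N; rewrite ?four.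
exists (i * p.+1 + p)%N; first by rewrite natrD iE p0 addr0.
rewrite mulrnDr four add0r Z4_double_odd ?odd_prime_neq2 //; apply/val_inj.
by case: k ke k0 => [[|[|[|[|]]]]].
Qed.

(** A proper subgroup either lies in the cyclic group of the elements [(i, k)]
    with [k] even, or meets the subgroup of order [p] trivially and is then
    generated by any of its elements with [k] odd. *)
Lemma dic_mnc : minimal_non_cyclic [set: dic p]%G.
Proof.
split.
  apply/negP=> /cyclic_abelian/centsP/(_ ((1, 0)%R : dic p)).
  rewrite inE => /(_ isT ((0, 1)%R : dic p)); rewrite inE => /(_ isT).
  rewrite /commute !dicM => /(congr1 fst); rewrite [LHS]/= [RHS]/=
     sgn1 mulr0 mulN1r addr0 add0r.
  by move=> E; move: Fp_2_neq0; rewrite -{1}E addNr eqxx.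
move=> H ltH; have [/exists_inP[x xH xo]|no] := boolP [exists x in H, odd x.2].
  apply: (cyclicS _ (cycle_cyclic x)); apply/subsetP=> y yH.
  have [n yn] := dic_odd_proj y xo.
  have wH : x ^- n * y \in H by rewrite groupM ?groupV ?groupX.
  have [/eqP|w1] := eqVneq (x ^- n * y) 1.
    by rewrite -eq_invg_mul invgK => /eqP <-; apply: mem_cycle.
  by case/andP: ltH => _ /negP[]; rewrite (dic_gen xH xo wH yn w1).
have [c cP] := dic_even_cyclic; apply: (cyclicS _ (cycle_cyclic c)).
apply/subsetP=> y yH; apply: cP; apply: contra no => yo.
by apply/exists_inP; exists y.
Qed.

Lemma dic_projJ (x y : dic p) : (x ^ y).2 = x.2.
Proof. by rewrite !dic_projM dic_projV addrC addrK. Qed.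

Lemma dic_conj0 (x y : dic p) : x.2 = 0%R -> x ^ y = if odd y.2 then x^-1 else x.
Proof.
case: x y => i k [j l] /= ->; rewrite /conjg !dicM !dicV /= add0r addNr.
rewrite mulrN mulrA sgn2 mul1r (addrC _ j) addKr sgn_odd oppr0 sgn0 mul1r.
by case: (odd l); rewrite ?mulN1r ?mul1r.
Qed.

(** An element of the subgroup of order [p] is itself such a [w]; any other
    element has the central involution [(0, 2)] among its powers. *)
Lemma dic_core (g : dic p) : g != 1 ->
  exists w, [/\ w \in <[g]>, w != 1 & forall h, w ^ h \in <[w]>].
Proof.
have normal0 (w : dic p) : w.2 = 0%R -> forall h, w ^ h \in <[w]>.
  by move=> w0 h; rewrite dic_conj0 //; case: ifP; rewrite ?groupV cycle_id.
have [g0 g1|g0 _] := eqVneq g.2 0%R.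
  by exists g; rewrite cycle_id; split=> //; apply: normal0.
have [n n2] : exists n, (g ^+ n).2 = (1 + 1)%R.
  exists (if odd g.2 then 2 else 1)%N; rewrite dic_proj_expg.
  by case: g.2 g0 => [[|[|[|[|?]]]] //= ?] _; apply/val_inj.
have n2' : (g ^+ (n * p)).2 = (1 + 1)%R.
  by rewrite expgM dic_proj_expg n2 Z4_double_odd // odd_prime_neq2.
have fix1 : (g ^+ (n * p)).1 = 0%R.
  rewrite expgM; case: (g ^+ n) n2 => i k /= ->.
  have cX m : (((i, 1 + 1)%R : dic p) ^+ m = (i *+ m, (1 + 1) *+ m)%R :> dic p).
    elim: m => [|m IHm]; first by rewrite expg0.
    by rewrite expgSr IHm dicM [(_, _).2]/= sgnD sgn2 mul1r !mulrSr.
  by rewrite cX /= -mulr_natr pchar_Fp_0 ?mulr0.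
exists (g ^+ (n * p)); split; first exact: mem_cycle.
  by apply/eqP=> /(congr1 snd); rewrite n2' => /(congr1 val).
move=> h; suff -> : g ^+ (n * p) ^ h = g ^+ (n * p) by apply: cycle_id.
move: fix1 n2'; case: (g ^+ _) => i k /= -> ->.
apply/conjg_fixP/commgP; rewrite /commute !dicM /= mulr0 add0r addr0 addrC.
by rewrite sgnD sgn2 mul1r.
Qed.

Definition dic_ker : {set dic p} := [set x | x.2 == 0%R].

Lemma dic_ker_group_set : group_set dic_ker.
Proof.
apply/group_setP; split=> [|x y]; rewrite !inE // dic_projM.
by move=> /eqP-> /eqP->; rewrite addr0.
Qed.
Canonical dic_ker_group := Group dic_ker_group_set.

Lemma card_dic_ker : #|dic_ker| = p.
Proof.
have -> : dic_ker = [set ((i, 0%R) : dic p) | i : 'F_p].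
  apply/setP=> -[i k]; rewrite inE /=; apply/eqP/imsetP=> [->|[j _ [_ ->]]//].
  by exists i.
by rewrite card_imset ?card_Fp // => i j [].
Qed.

Lemma dic_ker_Sylow : p.-Sylow([set: dic p]) dic_ker.
Proof.
have p'4 : p^'.-nat 4.
  by rewrite p'natE // -[4]/(2 ^ 2)%N Euclid_dvdX // andbT dvdn_prime2 //; apply/eqP.
rewrite pHallE subsetT /= card_dic_ker card_dic // partnM ?(prime_gt0 p_pr) //.
by rewrite (part_p'nat p'4) mul1n part_pnat_id // pnat_id.
Qed.

Lemma dic_ker_normal : dic_ker <| [set: dic p].
Proof.
rewrite /normal subsetT; apply/subsetP=> y _; rewrite inE.
by apply/subsetP=> _ /imsetP[x xP ->]; rewrite !inE dic_projJ in xP *.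
Qed.

End Structure.

(** * The two solutions *)

Section Models.
Import GRing.Theory.
Local Open Scope ring_scope.
Variables (p : nat) (c : bool).
Hypotheses (p_pr : prime p) (p_neq2 : p <> 2%N).

Definition dic_shift (k : 'Z_4) : 'Z_4 := if c && odd k then -1 else 1.
Definition dic_step (x : dic p) : dic p := (sgn p x.2, dic_shift x.2).

Lemma sgn_shift k : sgn p (dic_shift k) = -1.
Proof. by rewrite /dic_shift; case: ifP => _; rewrite ?sgnN /sgn /= expr1. Qed.

Lemma dic_step_cyc : cycle_law dic_step.
Proof.
move=> g h; rewrite !dicM !dicV /dic_step /= !sgnD !sgnN !sgn_shift.
congr (_, _); first by rewrite !mulrN1 !mulN1r !opprK addrC.
rewrite /dic_shift; case: c; case: g.2 => [[|[|[|[|?]]]] //= ?];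
  by case: h.2 => [[|[|[|[|?]]]] //= ?]; apply/val_inj.
Qed.

Lemma dic_step_diag : injective (diag dic_step).
Proof.
move=> x y E; suff kE : x.2 = y.2.
  have sE : dic_step x = dic_step y by rewrite /dic_step kE.
  by apply: (mulIg (dic_step x)^-1%g); rewrite [in RHS]sE.
have: (diag dic_step x).2 = (diag dic_step y).2 by rewrite E.
rewrite /diag !dicM !dicV /= /dic_shift; case: c;
 case: x.2 => [[|[|[|[|?]]]] //= ?];
  by case: y.2 => [[|[|[|[|?]]]] //= ?] /(congr1 val) //= _; apply/val_inj.
Qed.

Lemma dic_step_gen : <<[set dic_step x | x : dic p]>>%g = setT.
Proof.
pose H := <<[set dic_step x | x : dic p]>>%G; change (H :=: setT).
have mem x : dic_step x \in H by apply/mem_gen/imset_f.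
pose x0 : dic p := (0, 0); pose x1 : dic p := (0, 1).
pose w := (dic_step x1 * (if c then dic_step x0 else (dic_step x0)^-1))%g.
have wH : w \in H by rewrite groupM //; case: c; rewrite ?groupV.
(* The second coordinates of the two steps are equal for [c = false] and
   opposite for [c = true]; either way they cancel in [w]. *)
have wE : w = (1 + 1, 0).
  rewrite /w /x0 /x1 /dic_step /dic_shift; case: c => /=.
    by rewrite dicM /= sgn0 sgn1 mulN1r opprK addNr.
  by rewrite dicV dicM /= !sgnN sgn0 sgn1 !mulN1r !opprK addrN.
apply: (dic_gen (mem x0) _ wH); rewrite ?wE //.
  by rewrite /= /dic_shift andbF.
by apply: contra (Fp_2_neq0 p_pr p_neq2) => /eqP/(congr1 fst) E; apply/eqP/E.
Qed.

End Models.

Section ModelSolutions.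
Import GRing.Theory.
Variable p : nat.
Hypotheses (p_pr : prime p) (p_neq2 : p <> 2).

Definition dic_sol (c : bool) : solution :=
  gsol (dic_step_cyc (p := p) c) (dic_step_diag (c := c)).

(** An isomorphism invariant of solutions which, for [n := p], tells the two
    models apart. *)
Definition sigma2_fixes (n : nat) (S : solution) : Prop :=
  exists x y z : S,
    iter n (sigma_of (@sol_map S) x \o sigma_of (@sol_map S) y) z = z.

Lemma sigma2_fixes_iso n S S' :
  solution_iso S S' -> sigma2_fixes n S -> sigma2_fixes n S'.
Proof.
move=> [f _ fM] [x [y [z E]]]; exists (f x), (f y), (f z).
have fS u v : sigma_of (@sol_map S') (f u) (f v) = f (sigma_of (@sol_map S) u v).
  by rewrite /sigma_of fM.
rewrite -[in RHS]E; elim: n {E} => //= n ->.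
by rewrite !fS.
Qed.

Lemma dic_sol_iter c (x y z : dic_sol c) n :
  iter n (sigma_of (@sol_map (dic_sol c)) x \o sigma_of (@sol_map (dic_sol c)) y) z
  = (z * (dic_step c y * dic_step c x) ^+ n)%g.
Proof.
elim: n => [|n IHn]; first by rewrite expg0 mulg1.
by rewrite iterS IHn /= /sigma_of /= -!mulgA -expgSr.
Qed.

(** If [c = true], the shifts by [1] and [-1] of the second coordinate cancel in
    [sigma_x sigma_y] for suitable [x, y]; if [c = false], this coordinate is
    shifted by [2], and [2 p] is not divisible by 4. *)
Lemma dic_sol_not_iso : ~ solution_iso (dic_sol true) (dic_sol false).
Proof.
move=> iso; have: sigma2_fixes p (dic_sol true).
  exists ((0, 0)%R : dic p), ((0, 1)%R : dic p), (1%g : dic p).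
  rewrite dic_sol_iter mul1g.
  have ->: (dic_step true ((0, 1)%R : dic p) * dic_step true ((0, 0)%R : dic p))%g
      = (1 + 1, 0)%R :> dic p.
    by rewrite dicM /dic_step /dic_shift /sgn /= expr0 expr1 mulN1r opprK addNr.
  by rewrite dic_expg0 -mulr_natr pchar_Fp_0 // mulr0.
case/(sigma2_fixes_iso iso) => x [y [z]]; rewrite dic_sol_iter => /(congr1 snd).
rewrite dic_projM dic_proj_expg dic_projM /= /dic_shift /= Z4_double_odd ?odd_prime_neq2 //.
by rewrite -[RHS]addr0 => /addrI/(congr1 val).
Qed.
End ModelSolutions.

Lemma dic_solutionP p c : prime p -> p <> 2 ->
  indecomposable (dic_sol p c) /\ perm_group_mnc (4 * p) (dic_sol p c).
Proof.
move=> p_pr p_neq2; have gen := dic_step_gen c p_pr p_neq2; split.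
  exact: gsol_indecomposable.
exists (dic p), [set: dic p]%G; split; first exact: dic_mnc.
  exact: card_dic.
exact: gsol_perm_group_isog.
Qed.

(** * Cycle maps on the cyclic group of order 4 *)

Section Z4.
Import GRing.Theory.

(** The cycle set identity for the map on integers modulo 4 with table [t],
    in a form that computes. *)
Definition Z4_law (t : seq nat) :=
  all (fun k => all (fun l =>
    nth 0 t ((l + (4 - nth 0 t k) %% 4) %% 4) + nth 0 t k
    == nth 0 t ((k + (4 - nth 0 t l) %% 4) %% 4) + nth 0 t l %[mod 4]) (iota 0 4)) (iota 0 4).

Lemma Z4_law_brute (a b c d : 'Z_4) :
  Z4_law [:: a : nat; b : nat; c : nat; d : nat] -> odd a ->
  exists e, [/\ b = if e then (- a)%R else a, c = a & d = if e then (- a)%R else a].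
Proof.
move=> H ao.
have : [&& b == a, c == a & d == a] || [&& b == - a, c == a & d == - a]%R.
  move: H ao; case: a => [[|[|[|[|?]]]] //= ?]; case: b => [[|[|[|[|?]]]] //= ?];
  case: c => [[|[|[|[|?]]]] //= ?]; by case: d => [[|[|[|[|?]]]] //= ?].
case/orP=> /and3P[/eqP-> /eqP-> /eqP->]; [by exists false | by exists true].
Qed.

Lemma Z4_cycle_law (t : 'Z_4 -> 'Z_4) :
  (forall k l, t (l - t k) + t k = t (k - t l) + t l)%R -> odd (t 0%R) ->
  exists e, forall k, t k = if e && odd k then (- t 0)%R else t 0%R.
Proof.
move=> law t0.
pose T := [:: t (inZp 0) : nat; t (inZp 1) : nat; t (inZp 2) : nat; t (inZp 3) : nat].
have TE (k : 'Z_4) : nth 0 T k = t k.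
  rewrite -[in RHS](valZpK k).
  by case: k => [[|[|[|[|?]]]] //= ?].
have TZ k : k < 4 -> nth 0 T k = t (inZp k) by move=> lt4; rewrite -TE /= modn_small.
have t00 : t 0%R = t (inZp 0) by congr t; apply/val_inj.
have [|//|e [t1 t2 t3]] := @Z4_law_brute (t (inZp 0)) (t (inZp 1)) (t (inZp 2)) (t (inZp 3)).
- apply/allP=> k; rewrite mem_iota => k4; apply/allP=> l; rewrite mem_iota => l4.
  have {}k4 : k < 4 := k4; have {}l4 : l < 4 := l4.
  rewrite -/T (TZ k k4) (TZ l l4).
  have sub i j : i < 4 -> nth 0 T ((i + (4 - t j) %% 4) %% 4) = t (inZp i - t j)%R.
    by move=> lt4; rewrite -(TE (inZp i - t j)%R) -{1}(modn_small lt4).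
  by rewrite !sub //; apply/eqP/(congr1 val (law (inZp k) (inZp l))).
- by rewrite -t00.
exists e => k; rewrite -[in LHS](valZpK k) t00.
by case: k => [[|[|[|[|?]]]] //= ?]; rewrite ?andbF ?andbT ?t1 ?t2 ?t3; case: (e).
Qed.

Lemma Z4_odd_mul (e k : 'Z_4) : odd e -> odd (e *+ k)%R = odd k.
Proof. by case: e => [[|[|[|[|?]]]] //= ?] _; case: k => [[|[|[|[|?]]]] //= ?]. Qed.

Lemma Z4_quad (k : 'Z_4) : (k *+ 4 = 0)%R.
Proof. by case: k => [[|[|[|[|?]]]] //= ?]; apply/val_inj. Qed.

Lemma Z4_double_neq0 (k : 'Z_4) : odd k -> (k *+ 2 != 0)%R.
Proof. by case: k => [[|[|[|[|]]]]]. Qed.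

Lemma Z4_shift (c : bool) (e k : 'Z_4) : odd e ->
  (e *+ dic_shift c k = if c && odd (e *+ k) then - e else e)%R.
Proof.
by case: c; case: e => [[|[|[|[|?]]]] //= ?] _; case: k => [[|[|[|[|?]]]] //= ?];
  apply/val_inj.
Qed.

End Z4.

(** * Classification *)

Section Classify.
Import GRing.Theory.
Local Open Scope group_scope.
Variable p : nat.
Hypotheses (p_pr : prime p) (p_neq2 : p <> 2).

(** Write [s x = q x * z x] as in [cocycle_split].  The generators [u := z 1]
    and [b := q 1] define the automorphism [f].  The components of [s (f x)] are
    [z (f x) = u ^ f x] and the element [q (f x)] of the complement [<[b]>],
    which is known from its class modulo the subgroup of order [p]. *)
Lemma cycle_map_classify (s : dic p -> dic p) :
  cycle_law s -> injective (diag s) -> <<[set s x | x : dic p]>> = setT ->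
  odd (s 1).2 ->
  exists c (f : dic p -> dic p), [/\ injective f, {morph f : x y / x * y} &
    forall x, s (f x) = f (dic_step c x)].
Proof.
move=> s_cyc s_diag s_gen s1o.
have [Q [q [z [tiQ qQ zP sE zJ]]]] := cocycle_split s_cyc s_diag s_gen p_pr
  (dic_ker_Sylow p_pr p_neq2) (dic_ker_normal p) (card_dic_ker p_pr).
have sP := cycle_map_coset s_cyc s_diag s_gen p_pr
  (dic_ker_Sylow p_pr p_neq2) (dic_ker_normal p) (card_dic_ker p_pr).
have z0 x : (z x).2 = 0%R by apply/eqP; have := zP x; rewrite inE.
have Qproj x y : x \in Q -> y \in Q -> x.2 = y.2 -> x = y.
  move=> xQ yQ E; apply/eqP; rewrite eq_mulgV1; apply/eqP/set1P.
  rewrite -[[set 1]]tiQ inE (groupM xQ (groupVr yQ)) andbT inE.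
  by rewrite dic_projM dic_projV E addrN.
have q2 x : (q x).2 = (s x).2 by rewrite sE dic_projM z0 addr0.
pose b := q 1; pose u := z 1.
have bo : odd b.2 by rewrite q2.
have bQ : b \in Q by apply: qQ.
have b41 : b ^+ 4 = 1.
  apply: Qproj; rewrite ?groupX //.
  by rewrite dic_proj_expg Z4_quad.
have b21 : b ^+ 2 != 1.
  by apply: contra (Z4_double_neq0 bo) => /eqP/(congr1 snd); rewrite dic_proj_expg => ->.
have up1 : u ^+ p = 1.
  by have := order_dvdG (zP 1); rewrite /= card_dic_ker // order_dvdn => /eqP.
have zE x : z x = u ^ x by rewrite -[x in LHS]mul1g zJ.
have u1 : u != 1.
  apply/eqP=> u1; have: <<[set s x | x : dic p]>> \subset Q.
    rewrite gen_subG; apply/subsetP=> _ /imsetP[x _ ->].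
    by rewrite sE zE u1 conj1g mulg1.
  rewrite s_gen => /subsetP/(_ ((1, 0)%R : dic p)); rewrite inE => /(_ isT) wQ.
  by have /(congr1 fst) := Qproj _ _ wQ (group1 Q) erefl.
have ub : u ^ b = u^-1 by rewrite (dic_conj0 _ (z0 1)) bo.
have sk x : (s x) = s (0%R, x.2).
  case: x => i k; rewrite -(sP (0%R, k) ((i, 0)%R : dic p)) ?inE //=.
  by rewrite dicM /= mulr0 add0r addr0.
have [c cP] : exists c, forall k, (s (0%R, k)).2 = (if c && odd k then - b.2 else b.2)%R.
  have -> : b.2 = (s (0, 0)%R).2 by rewrite q2.
  apply: (@Z4_cycle_law (fun k => (s (0%R, k)).2)) => [k l|]; last by [].
  have := congr1 snd (s_cyc ((0, k)%R : dic p) ((0, l)%R : dic p)).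
  by rewrite !dic_projM 2!(sk (_ * _)) !dic_projM !dic_projV.
exists c, (dic_map u b); split; [exact: dic_map_inj | exact: dic_mapM |] => x.
have uX2 n : (u ^+ n).2 = 0%R by rewrite dic_proj_expg z0 mul0rn.
have f2 : (dic_map u b x).2 = (b.2 *+ x.2)%R.
  by rewrite /dic_map dic_projM uX2 addr0 dic_proj_expg.
rewrite sE; congr (_ * _).
  apply: Qproj; rewrite ?groupX //.
  by rewrite q2 sk cP dic_proj_expg Z4_shift ?f2.
rewrite zE (dic_conj0 _ (z0 1)) f2 Z4_odd_mul //= sgn_odd.
have u_1 : u ^+ (1 : 'F_p)%R = u by rewrite /= modn_small ?expg1.
by case: (odd x.2); rewrite ?(expg_FpN p_pr up1) u_1.
Qed.

Lemma dic_solution_complete (S : solution) :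
  indecomposable S -> perm_group_mnc (4 * p) S ->
  exists c, solution_iso S (dic_sol p c).
Proof.
move=> indec [gT [G [mncG oG isoG]]].
have [u [b [uG bG ou ob ub]]] := mnc_generators p_pr p_neq2 mncG oG.
have up1 : u ^+ p = 1 by rewrite -ou expg_order.
have b41 : b ^+ 4 = 1 by rewrite -ob expg_order.
have u1 : u != 1 by rewrite -order_gt1 ou prime_gt1.
have b21 : b ^+ 2 != 1 by rewrite -order_dvdn ob.
have f_inj := dic_map_inj p_pr up1 b41 ub u1 b21 p_neq2.
have fM := dic_mapM p_pr up1 b41 ub.
have fG : dic_map u b @: [set: dic p] = G.
  apply/eqP; rewrite eqEcard card_imset // oG card_dic // leqnn andbT.
  by apply/subsetP=> _ /imsetP[x _ ->]; rewrite groupM ?groupX.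
have [phi [phiM phi_inj' phiP']] := perm_group_isog_inj f_inj fM fG isoG.
have {}phiM g h : phi (g * h) =1 phi g \o phi h by apply: phiM; rewrite inE.
have phi_inj g h : phi g =1 phi h -> g = h by apply: phi_inj'; rewrite inE.
have phiP f : perm_group f <-> exists g, phi g =1 f.
  by rewrite phiP'; split=> -[g]; [exists g | exists g; rewrite ?inE].
have free := phi_free phiM phi_inj phiP indec (dic_core p_pr p_neq2).
have [x0] := sol_inhabited S.
have [s [sP _ _ s_gen]] := cycle_map_of_solution phiM phi_inj phiP indec (free x0).
(* The even elements form a proper subgroup, which cannot contain all the
   [s g]; a point where [s g] is odd becomes the new base point. *)
have [g go] : exists g, odd (s g).2.
  apply/existsP; apply: contraT; rewrite negb_exists => /forallP even.
  have gE : group_set [set x : dic p | ~~ odd x.2].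
    apply/group_setP; split=> [|x y]; rewrite !inE // dic_projM /= odd_mod // oddD.
    by move=> /negbTE-> /negbTE->.
  have: <<[set s x | x : dic p]>> \subset Group gE.
    by rewrite gen_subG; apply/subsetP=> _ /imsetP[x _ ->]; rewrite inE.
  by rewrite s_gen => /subsetP/(_ ((0, 1)%R : dic p)); rewrite !inE => /(_ isT).
pose x1 := pt phi x0 g.
have [t [tP t_cyc t_diag t_gen]] :=
  cycle_map_of_solution phiM phi_inj phiP indec (free x1).
have t1 : odd (t 1).2.
  suff -> : t 1 = s g by [].
  apply: invg_inj; apply: (phi_inj) => y; rewrite tP sP.
  by rewrite /pt invg1 (phi1 phiM phi_inj phiP).
have [c [f [f_inj' fM' ft]]] := cycle_map_classify t_cyc t_diag t_gen t1.
have [f' fK f'K] := injF_bij f_inj'.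
exists c; apply: (@solution_iso_of_sigma S (dic_sol p c) (fun x => pt phi x1 (f x))).
  have ex y : exists x, pt phi x1 (f x) = y.
    have [h /phiP[k hk] <-] := indec x1 y; exists (f' k^-1).
    by rewrite f'K /pt invgK hk.
  (* The points of [S] form an arbitrary type: inverting the bijection from
     [dic p] onto them is a use of choice. *)
  pose inv y := proj1_sig (constructive_indefinite_description _ (ex y)).
  have invK y : pt phi x1 (f (inv y)) = y.
    by rewrite /inv; case: constructive_indefinite_description.
  exists inv => // x; apply: f_inj'; apply: (pt_inj phiM phi_inj phiP (free x1)).
  exact: invK.
by move=> x y; rewrite -tP /sigma_of /= fM' -ft /pt invMg phiM.
Qed.

End Classify.

Theorem corollary4p8 (p : nat) (p_prime : prime p) (p_neq2 : p <> 2) :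
  exactly_two_up_to_iso
    (fun S : solution => indecomposable S /\ perm_group_mnc (4 * p) S).
Proof.
exists (dic_sol p true), (dic_sol p false); split.
- exact: (dic_solutionP _ p_prime p_neq2).
- exact: (dic_solutionP _ p_prime p_neq2).
- exact: dic_sol_not_iso.
move=> S [indec mnc]; have [[] iso] := dic_solution_complete p_prime p_neq2 indec mnc.
  by left.
by right.
Qed.
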